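(* Let $s,n,k,L\ge 1$ be integers with $L\le s$, let $\mathbb{F}_q$ be a finite field with $q>sn>k$, let $\gamma$ be a generator of $\mathbb{F}_q^\times$, and let $(\alpha_1,\dots,\alpha_n)\in\mathbb{F}_q^n$ be appropriate. Put $R=\frac{k}{sn}$. Then the folded Reed--Solomon code $\mathsf{FRS}_{n,k}^{(s,\gamma)}(\alpha_1,\dots,\alpha_n)$ over the alphabet $\mathbb{F}_q^s$ is $\left(\frac{L}{L+1}\left(1-\frac{sR}{s-L+1}\right),L\right)$ list-decodable, and in fact $\left(\frac{L}{L+1}\left(1-\frac{sR}{s-L+1}\right),L\right)$ average-radius list-decodable.
   Context: Appropriate: $(\alpha_1,\dots,\alpha_n)\in\mathbb{F}_q^n$ is appropriate (with respect to $s$ and the generator $\gamma$) if the $sn$ elements $\gamma^i\alpha_j$, $i\in\{0,\dots,s-1\}$, $j\in\{1,\dots,n\}$, are pairwise distinct. Folded Reed--Solomon code: $\mathsf{FRS}^{(s,\gamma)}_{n,k}(\alpha_1,\dots,\alpha_n)=\{\mathcal{C}(f): f\in\mathbb{F}_q[x],\ \deg f<k\}\subseteq(\mathbb{F}_q^s)^n$, where $\mathcal{C}(f)=(F_1,\dots,F_n)$ and $F_i=(f(\alpha_i),f(\gamma\alpha_i),\dots,f(\gamma^{s-1}\alpha_i))\in\mathbb{F}_q^s$. Its block length is $n$ and its rate is $R=\frac{k}{sn}$. List-decodability: for $x,y\in\Sigma^n$ let $\delta(x,y)$ be the fraction of coordinates in which $x$ and $y$ differ. A code $C\subseteq\Sigma^n$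 is $(\rho,L)$ list-decodable if for every $y\in\Sigma^n$ there are at most $L$ codewords $c\in C$ with $\delta(c,y)\le\rho$. It is $(\rho,L)$ average-radius list-decodable if there do not exist $y\in\Sigma^n$ and pairwise distinct $x_1,\dots,x_{L+1}\in C$ with $\frac{1}{L+1}\sum_{i=1}^{L+1}\delta(x_i,y)\le\rho$. (If $\rho<0$ these hold vacuously.) *)

(* Defs.v *)
From HB Require Import structures.
From mathcomp Require Import all_boot all_order all_algebra all_fingroup all_solvable.

Set Implicit Arguments.
Unset Strict Implicit.
Unset Printing Implicit Defensive.

Import Order.TTheory GRing.Theory Num.Theory.

Local Open Scope ring_scope.

Notation word Sigma n := {ffun 'I_n -> Sigma}.

Definition rel_dist (Sigma : finType) (n : nat) (x y : word Sigma n) : rat :=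
  #|[set i | x i != y i]|%:R / n%:R.

Definition list_decodable (Sigma : finType) (n : nat)
    (C : {set word Sigma n}) (rho : rat) (L : nat) : Prop :=
  forall y : word Sigma n, (#|[set c in C | (rel_dist c y <= rho)%R]| <= L)%N.

Definition avg_list_decodable (Sigma : finType) (n : nat)
    (C : {set word Sigma n}) (rho : rat) (L : nat) : Prop :=
  ~ exists (y : word Sigma n) (x : 'I_L.+1 -> word Sigma n),
      [/\ injective x,
          forall i, x i \in C
        & (L.+1%:R)^-1 * \sum_(i < L.+1) rel_dist (x i) y <= rho].

Definition appropriate (F : finFieldType) (s n : nat) (gamma : F)
    (alpha : 'I_n -> F) : Prop :=
  injective (fun p : 'I_s * 'I_n => gamma ^+ p.1 * alpha p.2).

Definition frs_encode (F : finFieldType) (s n : nat) (gamma : F)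
    (alpha : 'I_n -> F) (f : {poly F}) : word 'rV[F]_s n :=
  [ffun j => \row_(i < s) f.[gamma ^+ i * alpha j]].

(* {poly_k F} consists of the polynomials of size at most k, i.e. of degree
   less than k (zero included). *)
Definition FRS (F : finFieldType) (s n k : nat) (gamma : F)
    (alpha : 'I_n -> F) : {set word 'rV[F]_s n} :=
  [set frs_encode s gamma alpha f | f : {poly_k F}].

(* Main.v *)
(* Let f_0, ..., f_L be distinct codeword polynomials and S_j the set of those
   agreeing with y on block j. Writing V_j for the space of polynomials that
   vanish on block j, the differences of polynomials in S_j lie in V_j, and by
   Guruswami and Kopparty (multiplicities of the roots of the folded Wronskian)
   (s - dim U + 1) * sum_j dim (U :&: V_j) <= (k - 1) * dim U for every U.
   If the f_i are affinely independent, U = span of all differences finishes the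
   proof, as dim (U :&: V_j) >= |S_j| - 1. In general one needs the following
   duality: if t * sum_j dim (U :&: V_j) <= K * dim U for all U, then
   t * sum_j (|S_j| - 1) <= K * L for any distinct points f_i. To see it, let
   h_S(tau) be the maximum over partitions P of S of the sum over A in P of
   |A| - 1 - tau * dim (span of the differences over A). This is convex and
   piecewise linear in tau, equals |S| - 1 at tau = 0 and 0 for large tau, and its
   slope is minus the sum of the dimensions attached to an optimal partition. By
   uncrossing, an optimal partition for S_j refines the optimal partition of the
   whole set, and the dimensions of its parts inside a part B sum to at most
   dim (span B :&: V_j). Hence K * h_full - t * sum_j h_{S_j} is nonincreasing in
   tau; it is nonnegative for large tau, so also at tau = 0. *)
Require Import Defs.
From HB Require Import structures.
From mathcomp Require Import all_boot all_order all_algebra all_fingroup all_solvable.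
From mathcomp Require Import zify ring lra.

Set Implicit Arguments.
Unset Strict Implicit.
Unset Printing Implicit Defensive.

Import Order.TTheory GRing.Theory Num.Theory.

Local Open Scope ring_scope.

(** * Partitions and the Dilworth truncation of a rank function *)

Section PartitionReplace.
Variable T : finType.
Implicit Types (A B S : {set T}) (P Q M : {set {set T}}).

Lemma cover_setD_disjoint P M : trivIset P -> M \subset P ->
  [disjoint cover M & cover (P :\: M)].
Proof.
move=> /trivIsetP tiP sMP; apply/pred0P=> x; apply/negP=> /andP[/= Mx PMx].
have {Mx} [A MA Ax] := bigcupP Mx.
have {PMx} [B /setDP[PB MB] Bx] := bigcupP PMx.
have neqAB : A != B by apply: contraNneq MB => <-.
have := disjointFr (tiP _ _ (subsetP sMP _ MA) PB neqAB) Ax.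
by rewrite Bx.
Qed.

Lemma partition_replace P Q M S :
    partition P S -> M \subset P -> partition Q (cover M) ->
  [disjoint Q & P :\: M] /\ partition (Q :|: (P :\: M)) S.
Proof.
move=> pP sMP pQ; have [/eqP covP tiP P0] := and3P pP.
have disM := cover_setD_disjoint tiP sMP.
have [/eqP covQ tiQ Q0] := and3P pQ.
split.
  apply/pred0P=> A; apply/negP=> /andP[/= QA PMA].
  have /set0Pn[x Ax] := partition_neq0 pQ QA.
  have Mx : x \in cover M by rewrite -covQ; apply/bigcupP; exists A.
  have := disjointFr disM Mx.
  by move=> /negP[]; apply/bigcupP; exists A.
apply/and3P; split.
- rewrite /cover bigcup_setU -/(cover Q) covQ -bigcup_setU.
  by rewrite -{1}(setIidPr sMP) setID -/(cover P) covP.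
- by apply: trivIsetU; rewrite ?trivIsetD // covQ.
- by rewrite !inE negb_or Q0 negb_and P0 orbT.
Qed.

Lemma partition_sub P M S : partition P S -> M \subset P ->
  partition M (cover M).
Proof.
move=> /and3P[_ tiP P0] sMP; rewrite /partition eqxx (trivIsetS sMP) //=.
exact: contra (subsetP sMP _) P0.
Qed.

Lemma partition1 A : A != set0 -> partition [set A] A.
Proof. by move=> A0; rewrite /partition cover1 eqxx trivIset1 inE eq_sym. Qed.

Lemma partition_split P S A (M := [set B in P | A :&: B != set0]) :
    partition P S -> A \subset S -> A != set0 ->
  partition [set A :&: B | B in M] A /\ {in M &, injective (setI A)}.
Proof.
move=> pP sAS A0; have [/eqP covP tiP P0] := and3P pP.
have inj : {in M &, injective (setI A)}.
  move=> B C; rewrite !inE => /andP[PB /set0Pn[x /setIP[Ax Bx]]] /andP[PC _] eqBC.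
  have /setIP[_ Cx] : x \in A :&: C by rewrite -eqBC inE Ax.
  by rewrite -(def_pblock tiP PB Bx) (def_pblock tiP PC Cx).
split=> //; apply/and3P; split.
- apply/eqP/setP=> x; apply/bigcupP/idP=> [[C /imsetP[B _ ->] /setIP[]]//|Ax].
  have /bigcupP[B PB Bx] : x \in cover P by rewrite covP (subsetP sAS).
  exists (A :&: B); rewrite ?inE ?Ax // imset_f // inE PB.
  by apply/set0Pn; exists x; rewrite inE Ax.
- apply/trivIsetP=> _ _ /imsetP[B + ->] /imsetP[C + ->] neq.
  rewrite !inE => /andP[PB _] /andP[PC _].
  have neqBC : B != C by apply: contraNneq neq => ->.
  have /trivIsetP/(_ _ _ PB PC neqBC) := tiP.
  rewrite -!setI_eq0 => /eqP eq0; rewrite setIACA eq0 setI0 eqxx //.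
- by apply/imsetP=> [[B]]; rewrite inE => /andP[_ /negP] + /esym/eqP.
Qed.

End PartitionReplace.

(** * Optimal partitions for an intersecting submodular rank *)

Section Truncation.
Variables (T : finType) (r : {set T} -> nat).
Implicit Types (A B S : {set T}) (P Q M : {set {set T}}).
Hypothesis r_small : forall A, (#|A| <= 1)%N -> r A = 0%N.
Hypothesis r_gt0 : forall A, (1 < #|A|)%N -> (0 < r A)%N.
Hypothesis r_mono : forall A B, A \subset B -> (r A <= r B)%N.
(** Restricted to intersecting pairs: two disjoint singletons have rank 0, but their union has
    positive rank. *)
Hypothesis r_submod : forall A B, A :&: B != set0 ->
  (r (A :|: B) + r (A :&: B) <= r A + r B)%N.

(* The parameter tau is measured in units of 1 / (2 * scale). Two partitions of
   rank sums a <> b have equal value only if |a - b| * tau is a multiple of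
   2 * scale, hence only if tau is even, because |a - b| divides the factorial. So
   all breakpoints are even, and odd tau are generic. *)
Definition scale := (\sum_A r A)`!.

Definition wt (tau : nat) A : int :=
  (2 * scale)%:Z * (#|A|%:Z - 1) - tau%:Z * (r A)%:Z.

Definition value tau P : int := \sum_(A in P) wt tau A.

Definition optimal tau S P := partition P S /\
  forall Q, partition Q S -> value tau Q <= value tau P.

Lemma valueE tau P S : partition P S ->
  value tau P = (2 * scale)%:Z * (#|S|%:Z - #|P|%:Z)
                - tau%:Z * (\sum_(A in P) r A)%N%:Z.
Proof.
move=> pP; rewrite (card_partition pP) /value /wt.
have sumZ (f : {set T} -> nat) :
  (\sum_(A in P) f A)%N%:Z = \sum_(A in P) (f A)%:Z by exact: big_morph.
by rewrite !sumZ sumrB -!mulr_sumr sumrB sumr_const natz.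
Qed.

Lemma scale_gt0 : (0 < scale)%N. Proof. exact: fact_gt0. Qed.

Lemma dvdn_scale e : (0 < e)%N -> (e <= \sum_A r A)%N -> (e %| scale)%N.
Proof. by move=> e0 leR; apply: dvdn_fact; rewrite e0. Qed.

Lemma optimal_local tau S P M Q : optimal tau S P -> M \subset P ->
  partition Q (cover M) -> value tau Q <= value tau M.
Proof.
move=> [pP optP] sMP pQ; have [dis pQP] := partition_replace pP sMP pQ.
have := optP _ pQP; rewrite /value (eq_bigl [predU Q & P :\: M]); last first.
  by move=> A; rewrite !inE.
rewrite bigU //= [\sum_(A in P) _](big_setID M) /=.
by rewrite (setIidPr sMP) lerD2r.
Qed.

(** The difference of two values is affine in [tau] and, by the choice of [scale], changes sign only
    at even [tau]; an order at an odd point persists at both even neighbours. *)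
Lemma optimal_adjacent m tau S P : optimal (2 * m).+1 S P ->
  (tau = 2 * m \/ tau = (2 * m).+2)%N -> optimal tau S P.
Proof.
move=> [pP optP] tauE; split=> // Q pQ; have := optP Q pQ.
rewrite (valueE _ pP) (valueE _ pQ) (valueE _ pP) (valueE _ pQ).
have bound P' : (\sum_(A in P') r A <= \sum_A r A)%N.
  by rewrite [leqRHS](bigID [in P']) leq_addr.
move: (bound P) (bound Q); set a := (\sum_(A in P) r A)%N.
set b := (\sum_(A in Q) r A)%N => leP leQ.
have [ltab|ltba|->] := ltngtP a b; last by rewrite !lerD2r.
- have /dvdnP[n ->] : (b - a %| scale)%N.
    by apply: dvdn_scale; [lia | apply: leq_trans leQ; lia].
  have -> : b%:Z = a%:Z + (b - a)%N%:Z by lia.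
  have : (0 < b - a)%N by lia.
  move: (b - a)%N => e e0 h.
  have {}h : e%:Z * (2 * n%:Z * (#|P|%:Z - #|Q|%:Z) - (2 * m).+1%:Z) <= 0 by lia.
  have {}h : 2 * n%:Z * (#|P|%:Z - #|Q|%:Z) - (2 * m).+1%:Z <= 0 by nia.
  (* Parity: an even integer at most [2m+1] is at most [2m]. *)
  have {}h : 2 * n%:Z * (#|P|%:Z - #|Q|%:Z) - tau%:Z <= 0.
    by move: h; move: (n%:Z * (#|P|%:Z - #|Q|%:Z)) (mulrA 2 n%:Z (#|P|%:Z - #|Q|%:Z)) => u <-; lia.
  suff : e%:Z * (2 * n%:Z * (#|P|%:Z - #|Q|%:Z) - tau%:Z) <= 0 by lia.
  by nia.
- have /dvdnP[n ->] : (a - b %| scale)%N.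
    by apply: dvdn_scale; [lia | apply: leq_trans leP; lia].
  have -> : a%:Z = b%:Z + (a - b)%N%:Z by lia.
  have : (0 < a - b)%N by lia.
  move: (a - b)%N => e e0 h.
  have {}h : e%:Z * (2 * n%:Z * (#|P|%:Z - #|Q|%:Z) + (2 * m).+1%:Z) <= 0 by lia.
  have {}h : 2 * n%:Z * (#|P|%:Z - #|Q|%:Z) + (2 * m).+1%:Z <= 0 by nia.
  have {}h : 2 * n%:Z * (#|P|%:Z - #|Q|%:Z) + tau%:Z <= 0.
    by move: h; move: (n%:Z * (#|P|%:Z - #|Q|%:Z)) (mulrA 2 n%:Z (#|P|%:Z - #|Q|%:Z)) => u <-; lia.
  suff : e%:Z * (2 * n%:Z * (#|P|%:Z - #|Q|%:Z) + tau%:Z) <= 0 by lia.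
  by nia.
Qed.

(** Adjoin the sets one at a time: each [B] meets the union built so far in at least [A :&: B]. *)
Lemma submod_chain A (s : seq {set T}) : (forall B, B \in s -> A :&: B != set0) ->
  (r (A :|: \bigcup_(B <- s) B) + \sum_(B <- s) r (A :&: B)
   <= r A + \sum_(B <- s) r B)%N.
Proof.
elim: s => [|B s IHs] meet; first by rewrite !big_nil setU0.
rewrite !big_cons setUCA; set C := A :|: _.
have : (r (B :|: C) + r (B :&: C) <= r B + r C)%N.
  apply: r_submod; have /set0Pn[x /setIP[Ax Bx]] := meet B (mem_head _ _).
  by apply/set0Pn; exists x; rewrite !inE Bx Ax.
have : (r (A :&: B) <= r (B :&: C))%N by rewrite r_mono // setIC setIS // subsetUl.
have : (r C + \sum_(B <- s) r (A :&: B) <= r A + \sum_(B <- s) r B)%N.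
  by apply: IHs => B' sB'; apply: meet; rewrite inE sB' orbT.
by lia.
Qed.

(* With M the set of parts of P that meet A, merging M in P and splitting A along
   M in Q cannot both lose value by submodularity; as tau is odd, there is no tie
   unless M is a singleton. *)
Lemma optimal_refines m S S' P Q A : S \subset S' ->
    optimal (2 * m).+1 S' P -> optimal (2 * m).+1 S Q -> A \in Q ->
  exists2 B, B \in P & A \subset B.
Proof.
move=> sSS' optP optQ QA; have [pP _] := optP; have [pQ _] := optQ.
have A0 := partition_neq0 pQ QA.
have sAS : A \subset S' := subset_trans (partitionS pQ QA) sSS'.
pose M := [set B in P | A :&: B != set0].
have sMP : M \subset P by apply/subsetP=> B; rewrite inE => /andP[].
have [pA injA] := partition_split pP sAS A0.
have pM := partition_sub pP sMP.
have sAM : A \subset cover M.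
  rewrite -(cover_partition pA); apply/bigcupsP=> _ /imsetP[B MB ->].
  by apply: subset_trans (bigcup_sup B MB); rewrite subsetIr.
have M0 : (0 < #|M|)%N.
  rewrite card_gt0; apply: contra_neq A0 => M0; apply/eqP.
  by rewrite -subset0 (subset_trans sAM) // M0 /cover big_set0.
have split : value (2 * m).+1 [set A :&: B | B in M] <= value (2 * m).+1 [set A].
  by apply: optimal_local optQ _ _; rewrite ?sub1set ?cover1.
have cM0 : cover M != set0.
  by apply: contra_neq A0 => cM0; apply/eqP; rewrite -subset0 -cM0.
have merge := optimal_local optP sMP (partition1 cM0).
move: split merge.
rewrite (valueE _ pA) (valueE _ pM) (valueE _ (partition1 A0)).
rewrite (valueE _ (partition1 cM0)) !big_set1 !cards1.
rewrite big_imset //= card_in_imset //.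
have := @submod_chain A (enum M).
rewrite !big_enum /= -/(cover M) (setUidPr sAM) => chain split merge.
have {}chain : (r (cover M) + \sum_(B in M) r (A :&: B) <= r A + \sum_(B in M) r B)%N.
  by apply: chain => B; rewrite mem_enum inE => /andP[].
suff M1 : (#|M| <= 1)%N.
  have /cards1P[B MB] : #|M| == 1%N by rewrite eqn_leq M1.
  exists B; first by rewrite (subsetP sMP) // MB set11.
  by rewrite (subset_trans sAM) // MB cover1.
have bound : (r (cover M) <= \sum_B r B)%N by rewrite (bigD1 (cover M)) //= leq_addr.
rewrite leqNgt; apply/negP=> M1.
move: bound chain split merge; have := scale_gt0; have dvd := dvdn_scale.
move: (\sum_(B in M) r (A :&: B))%N (\sum_(B in M) r B)%N => x y.
move=> sc0 bound chain split merge.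
have tau_chain := leq_mul (leqnn (2 * m).+1) chain.
(* Splitting, merging and the submodular chain form a cycle of inequalities, which forces
   equality. *)
have tight : (2 * scale * (#|M| - 1) + (2 * m).+1 * y = (2 * m).+1 * r (cover M))%N.
  move: split merge tau_chain M1; clear; move: #|M| #|A| #|cover M| (r A).
  by move: (r (cover M)) scale (2 * m).+1; lia.
move=> {split merge chain tau_chain}.
have e0 : (0 < r (cover M) - y)%N.
  rewrite subn_gt0 ltnNge; apply/negP=> /(leq_mul (leqnn (2 * m).+1)).
  have : (0 < scale * (#|M| - 1))%N by rewrite muln_gt0 sc0 subn_gt0.
  by move=> pos; rewrite -tight leqNgt -mulnA -[X in (X < _)%N]add0n ltn_add2r muln_gt0 pos.
have E : (2 * scale * (#|M| - 1) = (2 * m).+1 * (r (cover M) - y))%N.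
  by rewrite [RHS]mulnBr -tight addnK.
(* The rank gap divides [scale]; cancelling it leaves an even number equal to [2m+1]. *)
have /dvdnP[n nE] := dvd _ e0 (leq_trans (leq_subr _ _) bound).
move: E; rewrite nE mulnA mulnAC [RHS]mulnC [LHS]mulnC => /eqP.
rewrite eqn_pmul2l // => /eqP/(congr1 odd).
by rewrite -mulnA oddS !mul2n !odd_double.
Qed.

(** Merging the blocks inside [B] does not raise the block count; if it also lowered the rank sum,
    the value would go up. *)
Lemma optimal_rank_sum m S P B : optimal (2 * m).+1 S P ->
  (\sum_(A in P | A \subset B) r A <= r (S :&: B))%N.
Proof.
move=> optP; have [pP _] := optP.
pose M := [set A in P | A \subset B].
have -> : (\sum_(A in P | A \subset B) r A = \sum_(A in M) r A)%N.
  by apply: eq_bigl => A; rewrite inE.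
have sMP : M \subset P by apply/subsetP=> A; rewrite inE => /andP[].
have [->|M0] := eqVneq M set0; first by rewrite big_set0.
have sM : cover M \subset S :&: B.
  apply/bigcupsP=> A; rewrite inE => /andP[PA sAB].
  by rewrite subsetI sAB (partitionS pP).
apply: leq_trans (r_mono sM).
have pM := partition_sub pP sMP.
have cM0 : cover M != set0.
  have /set0Pn[A MA] := M0; have := partition_neq0 pM MA.
  by apply: contra_neq => cM0; apply/eqP; rewrite -subset0 -cM0 bigcup_sup.
have := optimal_local optP sMP (partition1 cM0).
rewrite (valueE _ pM) (valueE _ (partition1 cM0)) big_set1 cards1.
have : (0 < #|M|)%N by rewrite card_gt0.
move: (#|M|) (#|cover M|) (r (cover M)) (\sum_(A in M) r A)%N => a b c d.
by have := scale_gt0; nia.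
Qed.

(** [preim_partition id S], the partition into singletons, witnesses that there is a partition to
    choose from. *)
Definition best tau S :=
  [arg max_(P > preim_partition id S | partition P S) value tau P]%O.

Lemma bestP tau S : optimal tau S (best tau S).
Proof.
rewrite /best; case: arg_maxP; first exact: preim_partitionP.
by move=> P pP optP; split.
Qed.

(* The function h_S of the header, scaled. *)
Definition envelope tau S := value tau (best tau S).

Lemma optimal_envelope tau S P : optimal tau S P -> envelope tau S = value tau P.
Proof.
move=> [pP optP]; have [pB optB] := bestP tau S.
by apply/le_anti; rewrite optP // optB.
Qed.

(** A partition optimal at [2m+1] is optimal at both even neighbours, so both values are read off
    the same affine function. *)
Lemma envelope_step m S :
  envelope (2 * m) S =
  envelope (2 * m.+1) S + 2 * (\sum_(A in best (2 * m).+1 S) r A)%N%:Z.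
Proof.
have opt := bestP (2 * m).+1 S; have [pB _] := opt.
rewrite (optimal_envelope (optimal_adjacent opt (or_introl (erefl _)))).
have -> : (2 * m.+1 = (2 * m).+2)%N by lia.
rewrite (optimal_envelope (optimal_adjacent opt (or_intror (erefl _)))).
rewrite !(valueE _ pB); move: (_ * _ : int) (\sum_(A in _) r A)%N => a b.
by move: (2 * m)%N => tau; lia.
Qed.

Lemma envelope0_le S : S != set0 -> envelope 0 S <= (2 * scale)%:Z * (#|S|.-1)%:Z.
Proof.
move=> S0; have [pB _] := bestP 0 S; rewrite /envelope (valueE _ pB).
have : (0 < #|best 0 S|)%N.
  rewrite card_gt0; apply: contra_neq S0 => B0.
  by rewrite -(cover_partition pB) B0 /cover big_set0.
have : (0 < #|S|)%N by rewrite card_gt0.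
rewrite mul0r subr0; move: #|S| #|best 0 S| => a b a0 b0.
by rewrite ler_wpM2l //; lia.
Qed.

Lemma envelope0_ge S : (2 * scale)%:Z * (#|S|.-1)%:Z <= envelope 0 S.
Proof.
have [pB optB] := bestP 0 S; rewrite /envelope.
have [S0|S0] := eqVneq S set0.
  move: pB; rewrite S0 partition_set0 => /eqP ->.
  by rewrite /value big_set0 cards0 mulr0.
apply: le_trans (optB _ (partition1 S0)); rewrite /value big_set1 /wt.
have S1 : (0 < #|S|)%N by rewrite card_gt0.
by rewrite mul0r subr0 ler_wpM2l //; lia.
Qed.

Lemma envelope_ge0 tau S : 0 <= envelope tau S.
Proof.
have [_ optB] := bestP tau S; rewrite /envelope.
apply: le_trans (optB _ (preim_partitionP id S)).
rewrite /value sumr_ge0 // => _ /imsetP[x Sx ->]; rewrite /wt.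
have -> : [set y in S | x == y] = [set x].
  by apply/setP=> y; rewrite !inE [x == y]eq_sym; case: eqP => [->|]; rewrite ?Sx ?andbF.
by rewrite cards1 r_small ?cards1 //; lia.
Qed.

(** For this [tau], rank 1 already outweighs [#|T|] elements, so no block has positive weight. *)
Lemma envelope_le0 S : envelope (2 * (scale * #|T|)) S <= 0.
Proof.
have [pB _] := bestP (2 * (scale * #|T|)) S; rewrite /envelope.
rewrite /value sumr_le0 // => A BA; rewrite /wt.
have A0 : (0 < #|A|)%N by rewrite card_gt0 (partition_neq0 pB).
have [A1|A1] := leqP #|A| 1.
  by rewrite r_small //; nia.
have r1 := r_gt0 A1; have leT := max_card (mem A).
have -> : #|A|%:Z - 1 = (#|A|.-1)%:Z by rewrite -subn1 subzn.
rewrite subr_le0 -!PoszM lez_nat mulnA -[leqRHS]mulnA leq_mul //.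
by rewrite (leq_trans (leq_pred _)) // (leq_trans leT) // leq_pmulr.
Qed.

End Truncation.

(** * Agreement sets of distinct vectors *)

Section Differences.
Variables (F : fieldType) (vT : vectType F) (T : finType) (x : T -> vT).
Implicit Types (A B : {set T}) (W : {vspace vT}).

(** The direction space of the affine hull of the points; taking all pairs avoids a base point and
    covers the empty set. *)
Definition diffs A : {vspace vT} :=
  (\sum_(p in setX A A) <[x p.1 - x p.2]>)%VS.

Lemma diffsP A W :
  reflect (forall a b, a \in A -> b \in A -> x a - x b \in W) (diffs A <= W)%VS.
Proof.
apply: (iffP subv_sumP) => [sW a b Aa Ab|sW [a b] /setXP[Aa Ab]]; last exact: sW.
by have := sW (a, b); rewrite inE Aa Ab => /(_ isT).
Qed.

Lemma mem_diffs A a b : a \in A -> b \in A -> x a - x b \in diffs A.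
Proof. by move=> Aa Ab; have /diffsP := subvv (diffs A); apply. Qed.

Lemma diffsS A B : A \subset B -> (diffs A <= diffs B)%VS.
Proof.
by move=> /subsetP sAB; apply/diffsP=> a b Aa Ab; rewrite mem_diffs ?sAB.
Qed.

(** A common point [c] serves as base point for the whole union. *)
Lemma diffsU A B : A :&: B != set0 -> (diffs (A :|: B) <= diffs A + diffs B)%VS.
Proof.
move=> /set0Pn[c /setIP[Ac Bc]].
have to_c a : a \in A :|: B -> x a - x c \in (diffs A + diffs B)%VS.
  by move=> /setUP[Aa|Ba]; [apply: subvP (addvSl _ _) _ _ | apply: subvP (addvSr _ _) _ _];
    apply: mem_diffs.
apply/diffsP=> a b /to_c xa /to_c xb.
by rewrite -(subrKA (x c)) -[x c - x b]opprB memvB.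
Qed.

Lemma dim_diffs_submod A B : A :&: B != set0 ->
  (\dim (diffs (A :|: B)) + \dim (diffs (A :&: B))
   <= \dim (diffs A) + \dim (diffs B))%N.
Proof.
move=> /diffsU/dimvS sU; rewrite -[leqRHS]dimv_sum_cap.
by apply: leq_add => //; apply: dimvS; rewrite subv_cap !diffsS ?subsetIl ?subsetIr.
Qed.

Lemma dim_diffs A : (\dim (diffs A) <= #|A|.-1)%N.
Proof.
have [->|/set0Pn[c Ac]] := eqVneq A set0.
  suff : (diffs set0 <= 0)%VS by rewrite subv0 => /eqP ->; rewrite dimv0.
  by apply/diffsP=> a b; rewrite inE.
have sA : (diffs A <= \sum_(a in A :\ c) <[x a - x c]>)%VS.
  have to_c a : a \in A -> x a - x c \in (\sum_(a in A :\ c) <[x a - x c]>)%VS.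
    move=> Aa; have [->|neq] := eqVneq a c; first by rewrite subrr mem0v.
    by apply: subvP (sumv_sup a _ (subvv _)) _ (memv_line _); rewrite !inE neq.
  apply/diffsP=> a b /to_c xa /to_c xb.
  by rewrite -(subrKA (x c)) -[x c - x b]opprB memvB.
have := leq_trans (dimvS sA) (dimv_leq_sum _ _ _) => /leq_trans; apply.
rewrite (cardsD1 c A) Ac /= -sum1_card leq_sum // => a _.
by rewrite dim_vline leq_b1.
Qed.

Hypothesis x_inj : injective x.

Lemma dim_diffs_gt0 A : (1 < #|A|)%N -> (0 < \dim (diffs A))%N.
Proof.
move=> /card_gt1P[a [b [Aa Ab neq]]].
rewrite lt0n dimv_eq0; apply: contra neq => /eqP A0.
have := mem_diffs Aa Ab; rewrite A0 memv0 subr_eq0 => /eqP /x_inj ->.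
exact: eqxx.
Qed.

Lemma dim_diffs_small A : (#|A| <= 1)%N -> \dim (diffs A) = 0%N.
Proof. by move=> A1; apply/eqP; have := dim_diffs A; lia. Qed.

Lemma dim_diffsS A B : A \subset B -> (\dim (diffs A) <= \dim (diffs B))%N.
Proof. by move=> sAB; rewrite dimvS ?diffsS. Qed.

(** * Comparing the envelopes of the agreement sets with that of the whole set *)

Let r A := \dim (diffs A).
Variables (J : finType) (V : J -> {vspace vT}) (S : J -> {set T}) (t K : nat).
(** Staying inside [diffs setT] caps [\dim U], so that one factor [t] can serve every [U]. *)
Hypothesis V_bound : forall U : {vspace vT}, (U <= diffs setT)%VS ->
  (t * \sum_j \dim (U :&: V j) <= K * \dim U)%N.
Hypothesis S_agree : forall j, (diffs (S j) <= V j)%VS.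

(** Compares the slopes at [2m+1], applying [V_bound] to the span of each block of the optimal
    partition of the whole set. *)
Lemma best_rank_sum m :
  (t * \sum_j \sum_(A in best r (2 * m).+1 (S j)) r A
   <= K * \sum_(B in best r (2 * m).+1 setT) r B)%N.
Proof.
set P := best r _ setT; have optP := bestP r (2 * m).+1 setT.
have le_j j : (\sum_(A in best r (2 * m).+1 (S j)) r A
               <= \sum_(B in P) \dim (diffs B :&: V j))%N.
  have optQ := bestP r (2 * m).+1 (S j); set Q := best _ _ _ in optQ *.
  (* Every block of [Q] lies in a block of [P], so grouping by the blocks of [P] loses no term. *)
  apply: (@leq_trans (\sum_(B in P) \sum_(A in Q | A \subset B) r A)).
    rewrite (exchange_big_dep (fun A => A \in Q)) => [|? ? _ /andP[]//] /=.
    apply: leq_sum => A QA.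
    have [B PB sAB] :=
      optimal_refines dim_diffsS dim_diffs_submod (subsetT _) optP optQ QA.
    by rewrite (bigD1 B) /= ?leq_addr // PB QA.
  apply: leq_sum => B PB.
  apply: leq_trans (optimal_rank_sum dim_diffsS B optQ) _.
  rewrite dimvS // subv_cap diffsS ?subsetIr //.
  by apply: subv_trans (S_agree j); rewrite diffsS ?subsetIl.
apply: (@leq_trans (t * \sum_j \sum_(B in P) \dim (diffs B :&: V j))).
  by rewrite leq_mul2l leq_sum ?orbT.
rewrite exchange_big !big_distrr /= leq_sum // => B PB.
by rewrite V_bound // diffsS ?subsetT.
Qed.

Lemma envelope_gap m :
  K%:Z * envelope r (2 * m) setT - t%:Z * \sum_j envelope r (2 * m) (S j)
  <= K%:Z * envelope r 0 setT - t%:Z * \sum_j envelope r 0 (S j).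
Proof.
elim: m => [|m IHm]; first by rewrite muln0.
apply: le_trans IHm; rewrite [envelope r (2 * m) setT]envelope_step.
under [\sum_j envelope r (2 * m) (S j)]eq_bigr do rewrite envelope_step.
rewrite big_split /= -mulr_sumr -(big_morph Posz PoszD (erefl _)).
have := best_rank_sum m; rewrite -lez_nat !PoszM => h.
by rewrite !mulrDr opprD addrACA lerDl subr_ge0 mulrCA [leRHS]mulrCA ler_pM2l.
Qed.

Lemma agreement_bound : (t * \sum_j #|S j|.-1 <= K * #|T|.-1)%N.
Proof.
have [T0|T0] := posnP #|T|.
  rewrite big1 ?muln0 // => j _; have := max_card (mem (S j)).
  by rewrite T0 leqn0 => /eqP ->.
have setT0 : [set: T] != set0 by rewrite -card_gt0 cardsT.
(* At this end point the whole set has a nonnegative envelope and the [S j] have nonpositive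
   ones. *)
have gap := envelope_gap (scale r * #|T|).
have upper := envelope0_le r setT0.
have lower : (2 * scale r)%:Z * (\sum_j #|S j|.-1)%N%:Z <= \sum_j envelope r 0 (S j).
  rewrite (big_morph Posz PoszD (erefl _)) mulr_sumr ler_sum // => j _.
  exact: envelope0_ge.
have endT := envelope_ge0 dim_diffs_small (2 * (scale r * #|T|)) [set: T].
have endS : \sum_j envelope r (2 * (scale r * #|T|)) (S j) <= 0.
  by rewrite sumr_le0 // => j _; rewrite (envelope_le0 dim_diffs_small dim_diffs_gt0).
have sc0 : (0 < 2 * scale r)%N by rewrite muln_gt0 scale_gt0.
rewrite cardsT in upper.
rewrite -(leq_pmul2l sc0) -lez_nat.
apply: (@le_trans _ _ (t%:Z * \sum_j envelope r 0 (S j))).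
  by rewrite mulnCA PoszM ler_wpM2l // PoszM.
apply: (@le_trans _ _ (K%:Z * envelope r 0 setT)); last first.
  by rewrite mulnCA PoszM ler_wpM2l // PoszM.
rewrite -subr_ge0; apply: le_trans gap.
by rewrite addr_ge0 // ?mulr_ge0 // oppr_ge0 mulr_ge0_le0.
Qed.

End Differences.

(** * The folded Wronskian *)

Section PolyDet.
Variable R : comNzRingType.

Lemma coef_comp_scaleX (p : {poly R}) c n : (p \Po (c *: 'X))`_n = c ^+ n * p`_n.
Proof.
rewrite coef_comp_poly.
under eq_bigr do rewrite exprZn coefZ coefXn mulrA mulrC mulr_natl mulrb.
rewrite -big_mkcond /=; have [lt_n|le_n] := ltnP n (size p).
  by rewrite (big_pred1 (Ordinal lt_n)) 1?mulrC // => i; rewrite eq_sym.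
rewrite big1 ?nth_default ?mulr0 // => i /eqP n_i.
by have := ltn_ord i; rewrite -n_i ltnNge le_n.
Qed.

Lemma size_comp_scaleX (p : {poly R}) c : (size (p \Po (c *: 'X)) <= size p)%N.
Proof.
by apply/leq_sizeP => j le_j; rewrite coef_comp_scaleX nth_default ?mulr0.
Qed.

Lemma prod_top_coef (I : Type) (l : seq I) (g : I -> {poly R}) (e : I -> nat) :
    (forall i, (size (g i) <= (e i).+1)%N) ->
  (size (\prod_(i <- l) g i)%R <= (\sum_(i <- l) e i).+1)%N /\
  (\prod_(i <- l) g i)`_(\sum_(i <- l) e i) = \prod_(i <- l) (g i)`_(e i).
Proof.
move=> le_e; elim: l => [|i l [IHs IHc]]; first by rewrite !big_nil size_poly1 coef1.
rewrite !big_cons; set q := \prod_(j <- l) g j in IHs IHc *.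
set m := (\sum_(j <- l) e j)%N in IHs IHc *; split.
  apply: leq_trans (size_polyMleq _ _) _.
  by have := le_e i; lia.
have lt_e : (e i < (e i + m).+1)%N by rewrite ltnS leq_addr.
(* Only index [e i] survives in the convolution: above it [g i] has zero coefficients, below it [q]
   is evaluated beyond its degree bound. *)
rewrite coefM (bigD1 (Ordinal lt_e)) //= addKn IHc [X in _ + X]big1 ?addr0 // => j neq.
have [lt_j|lt_j|eq_j] := ltngtP j (e i).
- rewrite [q`_ _]nth_default ?mulr0 //; apply: (leq_trans IHs); lia.
- by rewrite [(g i)`_ _]nth_default ?mul0r // (leq_trans (le_e i)).
- by case/eqP: neq; apply: val_inj.
Qed.

(** The bounds depend on the row only, and each Leibniz term takes one entry per row, so all terms
    share the same degree bound. *)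
Lemma det_top_coef d (M : 'M[{poly R}]_d) (e : 'I_d -> nat) :
    (forall i j, (size (M i j) <= (e i).+1)%N) ->
  (size (\det M) <= (\sum_i e i).+1)%N /\
  (\det M)`_(\sum_i e i) = \det (\matrix_(i, j) (M i j)`_(e i)).
Proof.
move=> le_e.
have term (s : 'S_d) := prod_top_coef (index_enum 'I_d) (fun i => le_e i (s i)).
have sgn (s : 'S_d) (p : {poly R}) :
    (-1) ^+ s * p = ((-1) ^+ s : R)%:P * p.
  by rewrite rmorph_sign.
split.
  apply: (leq_trans (size_sum _ _ _)); apply/bigmax_leqP => s _.
  by rewrite sgn mul_polyC (leq_trans (size_scale_leq _ _)) //; case: (term s).
rewrite coef_sum; apply: eq_bigr => s _.
rewrite sgn coefCM; have [_ ->] := term s; congr (_ * _).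
by apply: eq_bigr => i _; rewrite mxE.
Qed.

End PolyDet.

Section FoldedWronskian.
Variables (F : fieldType) (gamma : F).

(** The Wronskian with derivatives replaced by dilations by powers of [gamma]. *)
Definition folded_wronskian d (f : 'I_d -> {poly F}) : {poly F} :=
  \det (\matrix_(b < d, a < d) (f b \Po (gamma ^+ a *: 'X))).

Lemma folded_wronskian_size d (f : 'I_d -> {poly F}) k :
  (forall b, (size (f b) <= k)%N) -> ((size (folded_wronskian f)).-1 <= k.-1 * d)%N.
Proof.
move=> le_k.
have le_e b a : (size ((\matrix_(b < d, a < d) (f b \Po (gamma ^+ a *: 'X))) b a)
                 <= k.-1.+1)%N.
  by rewrite mxE (leq_trans (size_comp_scaleX _ _)) // (leq_trans (le_k b)) // leqSpred.
have [szW _] := det_top_coef (e := fun=> k.-1) le_e.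
by move: szW; rewrite sum_nat_const card_ord mulnC /folded_wronskian; case: (size _).
Qed.

(* The coefficient at the sum of the degrees is the product of the leading
   coefficients times a Vandermonde determinant in the gamma ^+ deg (f b). *)
Lemma folded_wronskian_neq0 d (f : 'I_d -> {poly F}) :
    (forall b, f b != 0) -> injective (fun b => size (f b)) ->
    (forall b c, gamma ^+ (size (f b)).-1 = gamma ^+ (size (f c)).-1 ->
       (size (f b)).-1 = (size (f c)).-1) ->
  folded_wronskian f != 0.
Proof.
move=> f0 size_inj gamma_inj; pose e b := (size (f b)).-1.
have sizeE b : size (f b) = (e b).+1 by rewrite prednK // size_poly_gt0.
have le_e b a : (size ((\matrix_(b < d, a < d) (f b \Po (gamma ^+ a *: 'X))) b a)
                 <= (e b).+1)%N.
  by rewrite mxE (leq_trans (size_comp_scaleX _ _)) // sizeE.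
have [_ coefW] := det_top_coef le_e.
suff: \det (\matrix_(i, j)
   ((\matrix_(b < d, a < d) (f b \Po (gamma ^+ a *: 'X))) i j)`_(e i)) != 0.
  by rewrite -coefW; apply: contraNneq; rewrite /folded_wronskian => ->; rewrite coef0.
pose v := \row_(b < d) gamma ^+ e b.
have -> : \matrix_(i, j) ((\matrix_(b < d, a < d)
      (f b \Po (gamma ^+ a *: 'X))) i j)`_(e i)
    = diag_mx (\row_b lead_coef (f b)) *m (Vandermonde d v)^T.
  apply/matrixP=> i j; rewrite mul_diag_mx !mxE coef_comp_scaleX mulrC.
  by rewrite -!exprM mulnC.
rewrite det_mulmx det_diag det_tr det_Vandermonde mulf_neq0 //.
  by apply/prodf_neq0 => b _; rewrite mxE lead_coef_eq0.
apply/prodf_neq0 => i _; apply/prodf_neq0 => j lt_ij; rewrite !mxE subr_eq0.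
apply: contraTneq lt_ij => /gamma_inj eq_e.
have /size_inj -> : size (f j) = size (f i) by rewrite !sizeE /e eq_e.
by rewrite ltnn.
Qed.

(** Dilation fixes scalars, so [M] acts on the matrix by left multiplication. This permits a
    different basis of the space at each root. *)
Lemma folded_wronskian_lin d (f g : 'I_d -> {poly F}) (M : 'M[F]_d) :
    (forall b, f b = \sum_c M b c *: g c) ->
  folded_wronskian f = (\det M)%:P * folded_wronskian g.
Proof.
move=> fE; rewrite /folded_wronskian -det_map_mx -det_mulmx; congr (\det _).
apply/matrixP=> b a; rewrite !mxE fE linear_sum /=; apply: eq_bigr => c _.
by rewrite !mxE comp_polyZ mul_polyC.
Qed.

(** Each Leibniz term contains an entry from every counted row, and all entries of such a row are
    divisible by ['X - p%:P]. *)
Lemma folded_wronskian_dvd d (f : 'I_d -> {poly F}) (p : F) r :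
    (r <= #|[set b | [forall a : 'I_d, root (f b) (gamma ^+ a * p)%R]]|)%N ->
  ('X - p%:P) ^+ r %| folded_wronskian f.
Proof.
set B := [set b | _] => le_r; rewrite /folded_wronskian /determinant.
apply: (big_ind (fun u => ('X - p%:P) ^+ r %| u)) => [|u v|s _];
  [exact: dvdp0 | exact: dvdp_add |].
apply: dvdp_mull; rewrite (bigID [in B]) /=; apply: dvdp_mulr.
apply: (dvdp_trans (dvdp_exp2l _ le_r)); rewrite -prodr_const.
apply: (big_ind2 (fun u v => u %| v)) => [|u u' v v'|b]; rewrite ?dvdp1 ?size_poly1 //.
  exact: dvdp_mul.
rewrite inE => /forallP/(_ (s b)) rt; rewrite mxE dvdp_XsubCl.
by rewrite /root horner_comp hornerZ hornerX.
Qed.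

(** Powers at distinct points are coprime, so their product divides [W]. *)
Lemma sum_mult_le (I : finType) (p : I -> F) (m : I -> nat) (W : {poly F}) :
    injective p -> W != 0 -> (forall i, ('X - (p i)%:P) ^+ m i %| W) ->
  (\sum_i m i <= (size W).-1)%N.
Proof.
move=> p_inj W0 dvdW.
have dvd_prod : \prod_i ('X - (p i)%:P) ^+ m i %| W.
  elim: (index_enum I) (index_enum_uniq I) => [|i l IHl] /=.
    by rewrite big_nil dvd1p.
  case/andP=> il /IHl dvdl; rewrite big_cons Gauss_dvdp ?dvdW //.
  apply: coprimep_expl; rewrite coprimep_sym coprimep_XsubC /root horner_prod.
  apply/eqP => /eqP; rewrite prodf_seq_eq0 => /hasP[j jl /=].
  rewrite horner_exp hornerXsubC expf_eq0 subr_eq0 => /andP[_ /eqP/p_inj eq_ij].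
  by rewrite eq_ij jl in il.
have := dvdp_leq W0 dvd_prod.
rewrite size_prod => [|i _]; last by rewrite expf_neq0 ?polyXsubC_eq0.
under eq_bigr do rewrite size_exp_XsubC -addn1.
rewrite big_split /= sum1_card -addSn addnK => lt_m.
by rewrite -ltnS (leq_trans lt_m) // leqSpred.
Qed.

End FoldedWronskian.

(** * Dimensions of polynomial subspaces vanishing on blocks *)

Section PolySubspaces.
Variables (F : finFieldType) (k : nat).
Implicit Type U : {vspace {poly_k F}}.

Definition coef_row d (z : 'I_d -> nat) (u : {poly_k F}) : 'rV[F]_d :=
  \row_i (u : {poly F})`_(z i).

Fact coef_row_is_linear d (z : 'I_d -> nat) : linear (coef_row z).
Proof. by move=> a u v; apply/rowP=> i; rewrite !mxE /= coefD coefZ. Qed.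

HB.instance Definition _ d (z : 'I_d -> nat) :=
  GRing.isLinear.Build F {poly_k F} 'rV[F]_d _ (coef_row z) (coef_row_is_linear z).

(* Taking one polynomial for each degree that occurs in U suffices: the linear map
   extracting the coefficients at these degrees is injective on U. *)
Lemma distinct_sizes U : exists f : 'I_(\dim U) -> {poly_k F},
  [/\ forall i, f i \in U, forall i, (f i : {poly F}) != 0
    & injective (fun i => size (f i))].
Proof.
pose Z := [set i : 'I_k | [exists u : {poly_k F}, (u \in U) && (size u == i.+1)]].
have leZ : (\dim U <= #|Z|)%N.
  pose g := linfun (coef_row (fun i : 'I_#|Z| => enum_val i : nat)).
  have g_inj : (U :&: lker g)%VS = 0%VS.
    apply/eqP; rewrite -subv0; apply/subvP=> u /memv_capP[Uu].
    rewrite memv_ker lfunE /= memv0 => /eqP /rowP gu0.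
    rewrite -val_eqE /=; apply: contraT => u0.
    have su0 : (0 < size u)%N by rewrite size_poly_gt0.
    have lt_k : ((size u).-1 < k)%N by rewrite prednK ?size_npoly.
    have Zu : Ordinal lt_k \in Z.
      by rewrite inE; apply/existsP; exists u; rewrite Uu /= prednK.
    have := gu0 (enum_rank_in Zu (Ordinal lt_k)).
    rewrite !mxE enum_rankK_in //= => /eqP.
    by rewrite -lead_coefE lead_coef_eq0 (negPf u0).
  rewrite -(limg_dim_eq g_inj) (leq_trans (dimvS (subvf _))) // dimvf.
  by rewrite /dim /= mul1n.
have ex i : exists u : {poly_k F}, (u \in U)
    && (size u == (enum_val (widen_ord leZ i) : nat).+1).
  by have := enum_valP (widen_ord leZ i); rewrite inE => /existsP.
pose f i := xchoose (ex i); exists f.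
have fP i := andP (xchooseP (ex i)).
split=> [i|i|i j eq_ij]; first by case: (fP i).
  by rewrite -size_poly_gt0; case: (fP i) => _ /eqP ->.
case: (fP i) (fP j) => _ /eqP szi [_ /eqP szj].
have := eq_ij; rewrite szi szj => -[/val_inj/enum_val_inj/(congr1 val)].
by move=> eqv; apply: val_inj.
Qed.

Definition eval_row s (p : 'I_s -> F) (u : {poly_k F}) : 'rV[F]_s :=
  \row_i (u : {poly F}).[p i].

Fact eval_row_is_linear s (p : 'I_s -> F) : linear (eval_row p).
Proof. by move=> a u v; apply/rowP=> i; rewrite !mxE /= hornerD hornerZ. Qed.

HB.instance Definition _ s (p : 'I_s -> F) :=
  GRing.isLinear.Build F {poly_k F} 'rV[F]_s _ (eval_row p) (eval_row_is_linear p).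

Definition vanishing s (p : 'I_s -> F) : {vspace {poly_k F}} :=
  lker (linfun (eval_row p)).

Lemma vanishingP s (p : 'I_s -> F) (u : {poly_k F}) :
  reflect (forall i, root u (p i)) (u \in vanishing p).
Proof.
rewrite memv_ker lfunE /=; apply: (iffP eqP) => [/rowP u0 i|u0].
  by have := u0 i; rewrite !mxE => /eqP.
by apply/rowP=> i; rewrite !mxE; apply/eqP/u0.
Qed.

(** A basis of [U :&: V] extended by a basis of a complement in [U]. *)
Lemma adapted_basis U (V : {vspace {poly_k F}}) :
  exists2 f : (\dim U).-tuple {poly_k F}, basis_of U f
    & (\dim (U :&: V) <= #|[set c | tnth f c \in V]|)%N.
Proof.
pose X := vbasis (U :&: V) ++ vbasis (U :\: V).
have dirUV : directv ((U :&: V) + (U :\: V)).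
  apply/directv_addP/eqP; rewrite capvC -subv0 -(capv_diff U V) capvS ?capvSr //.
have basX : basis_of U X.
  rewrite -[U in basis_of U](addv_diff_cap U V) addvC.
  by apply: cat_basis; rewrite ?vbasisP.
have szX : size X == \dim U by rewrite (size_basis (X := in_tuple X) basX).
exists (Tuple szX) => //.
have lt_c (i : 'I_(\dim (U :&: V))) : (i < \dim U)%N.
  by rewrite (leq_trans (ltn_ord i)) // dimvS // capvSl.
pose h i := Ordinal (lt_c i).
have h_inj : injective h by move=> i j /(congr1 val)/= /val_inj.
rewrite -[leqLHS]card_ord -(card_imset _ h_inj) subset_leq_card //.
apply/subsetP=> _ /imsetP[i _ ->]; rewrite inE (tnth_nth 0) /= nth_cat size_tuple ltn_ord.
have := vbasis_mem (mem_nth 0 (_ : i < size (vbasis (U :&: V)))%N).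
by rewrite size_tuple => /(_ (ltn_ord i)); rewrite memv_cap => /andP[].
Qed.

Variables (gamma : F) (s n : nat) (alpha : 'I_n -> F).
Hypothesis alphaP : appropriate s gamma alpha.
Hypothesis gamma_inj : forall a b, (a < k)%N -> (b < k)%N ->
  gamma ^+ a = gamma ^+ b -> a = b.

Definition block_vanishing j := vanishing (fun i : 'I_s => gamma ^+ i * alpha j).

(** Counts roots of a nonzero folded Wronskian of elements of [U]: the right side bounds its degree,
    the left side is a total of root multiplicities. *)
Lemma sum_dim_vanishing U : (\dim U <= s)%N ->
  ((s - \dim U).+1 * \sum_j \dim (U :&: block_vanishing j) <= k.-1 * \dim U)%N.
Proof.
move=> le_s; have [U0|U_gt0] := posnP (\dim U).
  rewrite big1 ?muln0 // => j _; apply/eqP; rewrite -leqn0 -U0.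
  by rewrite dimvS // capvSl.
have [g [gU g0 g_inj]] := distinct_sizes U.
pose gp b : {poly F} := g b.
have W0 : folded_wronskian gamma gp != 0.
  apply: folded_wronskian_neq0 => // b c; apply: gamma_inj.
    by rewrite prednK ?size_poly_gt0 ?g0 ?size_npoly.
  by rewrite prednK ?size_poly_gt0 ?g0 ?size_npoly.
(* Only the first [s - \dim U + 1] points of a block: from these, all [\dim U] dilations stay inside
   the block. *)
pose p (ij : 'I_(s - \dim U).+1 * 'I_n) := gamma ^+ ij.1 * alpha ij.2.
have le_i (i : 'I_(s - \dim U).+1) (a : 'I_(\dim U)) : (a + i < s)%N.
  by have := ltn_ord i; have := ltn_ord a; lia.
have le_i0 (i : 'I_(s - \dim U).+1) : (i < s)%N by have := ltn_ord i; lia.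
have p_inj : injective p.
  move=> [i j] [i' j'] eq_p.
  have := @alphaP (Ordinal (le_i0 i), j) (Ordinal (le_i0 i'), j') eq_p.
  by case=> eq_i ->; congr (_, _); apply: val_inj.
have dvdW ij : ('X - (p ij)%:P) ^+ \dim (U :&: block_vanishing ij.2)
    %| folded_wronskian gamma gp.
  case: ij => i j /=; have [f basf le_f] := adapted_basis U (block_vanishing j).
  pose fp c : {poly F} := tnth f c.
  (* Passing to a basis adapted to block [j] costs only a constant factor. *)
  have -> : folded_wronskian gamma gp
     = (\det (\matrix_(b, c) coord f c (g b)))%:P * folded_wronskian gamma fp.
    apply: folded_wronskian_lin => b; rewrite /gp [g b](coord_basis basf (gU b)).
    rewrite linear_sum /=; apply: eq_bigr => c _.
    by rewrite mxE /fp (tnth_nth 0).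
  apply/dvdp_mull/folded_wronskian_dvd/(leq_trans le_f)/subset_leq_card.
  apply/subsetP=> c; rewrite !inE => /vanishingP rt; apply/forallP=> a.
  by have := rt (Ordinal (le_i i a)); rewrite /= exprD mulrA.
have := sum_mult_le p_inj W0 dvdW.
rewrite -(pair_bigA _ (fun _ j => \dim (U :&: block_vanishing j))) /=.
rewrite sum_nat_const card_ord => /leq_trans; apply.
by apply: folded_wronskian_size => b; apply: size_npoly.
Qed.

End PolySubspaces.

(** * Folded Reed-Solomon codes *)

Lemma avg_list_decodable_sub (Sigma : finType) n (C : {set word Sigma n}) rho L :
  avg_list_decodable C rho L -> list_decodable C rho L.
Proof.
move=> avg y; rewrite leqNgt; apply/negP => lt_L; apply: avg.
pose x i := enum_val (widen_ord lt_L i).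
have xP i : (x i \in C) && (rel_dist (x i) y <= rho).
  by have := enum_valP (widen_ord lt_L i); rewrite inE.
exists y, x; split=> [i j /enum_val_inj/(congr1 val)/= /val_inj // |i|].
  by have /andP[] := xP i.
rewrite mulrC ler_pdivrMr ?ltr0n // mulr_natr -[X in _ *+ X]card_ord -sumr_const.
by apply: ler_sum => i _; have /andP[] := xP i.
Qed.

Lemma primitive_exp_inj (F : finFieldType) (gamma : {unit F}) a b :
    generator [set: {unit F}]%g gamma ->
    (a < #|F|.-1)%N -> (b < #|F|.-1)%N ->
  val gamma ^+ a = val gamma ^+ b -> a = b.
Proof.
move=> /eqP genF lt_a lt_b; rewrite -!FinRing.val_unitX => /val_inj/eqP.
have ord_gamma : #[gamma]%g = #|F|.-1 by rewrite /order -genF card_finField_unit.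
by rewrite eq_expg_mod_order ord_gamma !modn_small // => /eqP.
Qed.

(** The differences of [L + 1] polynomials span dimension at most [L], so [s - L + 1] may stand for
    [s - \dim U + 1] throughout. *)
Lemma frs_agreement_le (F : finFieldType) (s n k L : nat) (gamma : F)
    (alpha : 'I_n -> F) (f : 'I_L.+1 -> {poly_k F}) (y : word 'rV[F]_s n) :
    (L <= s)%N -> appropriate s gamma alpha ->
    (forall a b, (a < k)%N -> (b < k)%N -> gamma ^+ a = gamma ^+ b -> a = b) ->
    injective f ->
  ((s - L).+1 * \sum_j #|[set i | frs_encode s gamma alpha (f i) j == y j]|.-1
   <= k.-1 * L)%N.
Proof.
move=> le_Ls app gamma_inj f_inj.
have -> : (k.-1 * L = k.-1 * #|'I_L.+1|.-1)%N by rewrite card_ord.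
apply: (agreement_bound f_inj (V := block_vanishing k gamma s alpha)) => [U sU|j].
  have le_L : (\dim U <= L)%N.
    by rewrite (leq_trans (dimvS sU)) // (leq_trans (dim_diffs _ _)) // cardsT card_ord.
  apply: leq_trans (sum_dim_vanishing app gamma_inj (leq_trans le_L le_Ls)).
  by rewrite leq_mul2r ltnS leq_sub2l // orbT.
apply/diffsP=> a b; rewrite !inE => /eqP eq_a /eqP eq_b.
apply/vanishingP=> i; rewrite /root hornerD hornerN subr_eq0.
have := congr1 (fun v : 'rV[F]_s => v 0 i) (etrans eq_a (esym eq_b)).
by rewrite !ffunE !mxE => ->.
Qed.

(** Double counting of the pairs of a word and a coordinate. *)
Lemma sum_distance_agreement (Sigma : finType) n m (x : 'I_m -> word Sigma n) y :
  (\sum_i #|[set j | x i j != y j]| + \sum_j #|[set i | x i j == y j]| = m * n)%N.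
Proof.
have cardE (T : finType) (P : pred T) : #|[set t | P t]| = (\sum_t P t)%N.
  by rewrite -sum1dep_card big_mkcond; apply: eq_bigr => t _; case: (P t).
under eq_bigr do rewrite cardE; under [in X in (_ + X)%N]eq_bigr do rewrite cardE.
rewrite [in X in (_ + X)%N]exchange_big -big_split /=.
under eq_bigr => i _.
  rewrite -big_split /=; under eq_bigr do rewrite addn_negb.
  over.
by rewrite sum_nat_const sum1_card !card_ord.
Qed.

Theorem theorem1p3 (s n k L : nat) (F : finFieldType)
    (gamma : {unit F}) (alpha : 'I_n -> F) :
  (1 <= s)%N -> (1 <= n)%N -> (1 <= k)%N -> (1 <= L)%N -> (L <= s)%N ->
  (s * n < #|F|)%N -> (k < s * n)%N ->
  generator [set: {unit F}]%g gamma ->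
  appropriate s (val gamma) alpha ->
  let R : rat := k%:R / (s%:R * n%:R) in
  let rho : rat :=
    L%:R / (L%:R + 1) * (1 - s%:R * R / (s%:R - L%:R + 1)) in
  list_decodable (FRS s k (val gamma) alpha) rho L /\
  avg_list_decodable (FRS s k (val gamma) alpha) rho L.
Proof.
move=> s_gt0 n_gt0 k_gt0 L_gt0 le_Ls lt_q lt_k genF app R rho.
suff avg : avg_list_decodable (FRS s k (val gamma) alpha) rho L.
  by split=> //; apply: avg_list_decodable_sub.
move=> [y [x [x_inj xC le_rho]]].
have /fin_all_exists[f fE] i : exists u : {poly_k F},
    x i = frs_encode s (val gamma) alpha u.
  by have /imsetP[u _ ->] := xC i; exists u.
have f_inj : injective f by move=> i j eq_f; apply: x_inj; rewrite !fE eq_f.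
(* [k < sn < q] keeps the exponents below the order [q - 1] of [gamma]. *)
have gamma_inj a b : (a < k)%N -> (b < k)%N ->
    val gamma ^+ a = val gamma ^+ b -> a = b.
  by move=> lt_a lt_b; apply: primitive_exp_inj; rewrite //; lia.
have := frs_agreement_le y le_Ls app gamma_inj f_inj.
under eq_bigr => j _ do under eq_finset => i do rewrite -fE.
have := sum_distance_agreement x y.
set D := (\sum_i #|_|)%N; set A := (\sum_j #|_|)%N; set A' := (\sum_j #|_|.-1)%N.
(* Only an inequality: a coordinate where no codeword agrees has truncated predecessor 0. *)
have leA : (A <= A' + n)%N.
  rewrite -[X in (_ + X)%N]card_ord -sum1_card -big_split /=.
  by apply: leq_sum => j _; rewrite addn1 leqSpred.
(* The radius hypothesis with denominators cleared. *)
have le_D : (D * (s - L).+1 + L * k <= L * n * (s - L).+1)%N.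
  have D_E : \sum_i rel_dist (x i) y = D%:R / n%:R.
    by rewrite -mulr_suml natr_sum.
  move: le_rho; rewrite D_E /rho /R -(ler_nat rat).
  have t_E : (s - L).+1%:R = s%:R - L%:R + 1 :> rat by rewrite -natr1 natrB.
  rewrite natrD !natrM t_E -[L.+1%:R]natr1.
  have : 0 < s%:R - L%:R + 1 :> rat by rewrite -t_E ltr0n.
  have : 0 < n%:R :> rat by rewrite ltr0n.
  have : 0 < s%:R :> rat by rewrite ltr0n.
  have : 0 <= L%:R :> rat by rewrite ler0n.
  move: (s%:R - L%:R + 1) => t; move: (s%:R) (n%:R) (L%:R) (k%:R) (D%:R).
  move=> s' n' L' k' D' L0 s0 n0 t0.
  have -> : (L' + 1)^-1 * (D' / n') = (D' * t) / ((L' + 1) * (n' * t)).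
    by field; rewrite !lt0r_neq0 //; lra.
  have -> : L' / (L' + 1) * (1 - s' * (k' / (s' * n')) / t)
      = (L' * n' * t - L' * k') / ((L' + 1) * (n' * t)).
    by field; rewrite !lt0r_neq0 //; lra.
  by rewrite ler_pM2r ?invr_gt0 ?mulr_gt0 //; lra.
move: leA le_D; move: D A A' => D A A' leA le_D DA leA'.
have : ((s - L).+1 * A <= k.-1 * L + (s - L).+1 * n)%N.
  by rewrite (leq_trans (leq_mul (leqnn _) leA)) // mulnDr leq_add2r.
have : (D * (s - L).+1 + A * (s - L).+1 = L.+1 * n * (s - L).+1)%N.
  by rewrite -mulnDl DA.
(* With [t = s - L + 1], the radius gives [A t >= n t + L k], while agreement gives
   [A t <= n t + L (k - 1)]. *)
move: le_D leA' L_gt0; rewrite -(prednK k_gt0) /=; move: (s - L).+1 k.-1 => t k'.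
by clear; nia.
Qed.
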